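(* Let $m,n,d\ge 1$ and let $X_i, f_i$ ($i=1,\dots,m$), $Y_i,g_i$ ($i=1,\dots,n$) satisfy the standing assumptions 1–3 listed in the context. Let $z^*$ be the optimal solution of the problem $F(z)\to\max_{z\in S}$ and let $\lambda^*$ be an optimal solution of the dual problem $G(\lambda)\to\min_{\lambda\in\mathbb R^d}$. If $\eta\in(0,1/\kappa]$, then for the sequence $\lambda_t$ generated by the fast gradient descent algorithm $$\lambda_t=\mu_{t-1}-\eta\,\Delta\widetilde z(\mu_{t-1}),\qquad \mu_t=\lambda_t+\frac{t-1}{t+2}(\lambda_t-\lambda_{t-1}),\qquad t\ge 1,\qquad \mu_0=\lambda_0\in\mathbb R^d,$$ we have, for all $t\ge 1$, $$|F(\widetilde z(\lambda_t))-F(z^* )|\le\frac{2K}{\sqrt{\sigma\eta}}\,\frac{\|\lambda_0-\lambda^*\|}{t+1},\qquad \|\Delta\widetilde z(\lambda_t)\|\le 2\sqrt{\frac{\kappa}{\eta}}\,\frac{\|\lambda_0-\lambda^*\|}{t+1}.$$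
   Context: Notation: $\mathbb R^d_+=\{x\in\mathbb R^d: x\ge 0 \text{ componentwise}\}$, $\langle\cdot,\cdot\rangle$ is the usual scalar product and $\|\cdot\|$ the Euclidean norm. A function $f:A\to\mathbb R$ on a convex set $A$ is $\sigma$-strongly convex ($\sigma>0$) if $f(\alpha x+(1-\alpha)y)\le\alpha f(x)+(1-\alpha)f(y)-\frac{\sigma}{2}\alpha(1-\alpha)\|x-y\|^2$ for all $x,y\in A$, $\alpha\in[0,1]$; $f$ is $\sigma$-strongly concave if $-f$ is $\sigma$-strongly convex. Standing assumptions. 1. The sets $X_i$ ($i=1,\dots,m$) and $Y_i$ ($i=1,\dots,n$) are convex, compact subsets of $\mathbb R^d_+$, and $[0,\varepsilon]^d\subset X_i\subset[0,c]^d$, $[0,\varepsilon]^d\subset Y_i\subset[0,c]^d$ with some $\varepsilon>0$, $c>0$. 2. The functions $f_i:X_i\to\mathbb R_+$ are $\sigma_i'$-strongly concave and the functions $g_i:Y_i\to\mathbb R_+$ are $\sigma_i''$-strongly convex ($\sigma_i',\sigma_i''>0$); all are non-decreasing in each argument, and $f_i(0)=g_i(0)=0$. 3. The functions $f_i$ are $K_i'$-Lipschitz and the functions $g_i$ are $K_i''$-Lipschitz. Definitions. $Z=\prod_{i=1}^m X_i\times\prod_{j=1}^n Y_j$, $S=\{(x,y)\in Z:\sum_{i=1}^m x_i=\sum_{j=1}^n y_j\}$, and $F(x,y)=\sum_{i=1}^m f_i(x_i)-\sum_{i=1}^n g_i(y_i)$ for $(x,y)\in Z$. For $\lambda\in\mathbb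 R^d$, $$\widetilde x_i(\lambda)=\arg\max_{x_i\in X_i}(f_i(x_i)-\langle\lambda,x_i\rangle),\qquad \widetilde y_i(\lambda)=\arg\max_{y_i\in Y_i}(\langle\lambda,y_i\rangle-g_i(y_i))$$ (unique maximizers), $\widetilde z(\lambda)=(\widetilde x(\lambda),\widetilde y(\lambda))$, and $$\Delta\widetilde z(\lambda)=\sum_{i=1}^n\widetilde y_i(\lambda)-\sum_{i=1}^m\widetilde x_i(\lambda).$$ The dual objective is $G(\lambda)=\sup_{(x,y)\in Z}\left(F(x,y)+\sum_{i=1}^n\langle\lambda,y_i\rangle-\sum_{i=1}^m\langle\lambda,x_i\rangle\right)$; it is differentiable with $\nabla G(\lambda)=\Delta\widetilde z(\lambda)$, and the dual problem is solvable. Constants: $$\sigma=\min\left\{\min_{1\le i\le m}\sigma_i',\min_{1\le i\le n}\sigma_i''\right\},\quad K=\left(\sum_{i=1}^m(K_i')^2+\sum_{i=1}^n(K_i'')^2\right)^{1/2},\quad \kappa=\sum_{i=1}^m\frac1{\sigma_i'}+\sum_{i=1}^n\frac1{\sigma_i''}.$$ *)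

(* Defs.v *)
From HB Require Import structures.
From mathcomp Require Import all_boot all_order all_algebra.
From mathcomp Require Import all_classical all_reals all_analysis.

Set Implicit Arguments.
Unset Strict Implicit.
Unset Printing Implicit Defensive.

Import Order.TTheory GRing.Theory Num.Theory.
Import numFieldNormedType.Exports.

Local Open Scope classical_set_scope.
Local Open Scope ring_scope.

(* R^d is 'rV[R]_d.  The library norm on 'rV[R]_d is the
   sup-norm, so the Euclidean norm is defined here; the two norms induce the same
   topology, hence `compact` needs no adjustment. *)

Definition dot (R : realType) (d : nat) (u v : 'rV[R]_d) : R :=
  \sum_(j < d) u ord0 j * v ord0 j.

Definition enorm (R : realType) (d : nat) (u : 'rV[R]_d) : R :=
  Num.sqrt (dot u u).

Definition orthant (R : realType) (d : nat) : set 'rV[R]_d :=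
  [set x | forall j, 0 <= x ord0 j].

Definition cube (R : realType) (d : nat) (a : R) : set 'rV[R]_d :=
  [set x | forall j, 0 <= x ord0 j <= a].

(* A function A -> R on a subset A of R^d is a total function 'rV[R]_d -> R of
   which only the values on A are ever constrained or used. *)

Definition strongly_convex (R : realType) (d : nat) (A : set 'rV[R]_d)
    (s : R) (f : 'rV[R]_d -> R) : Prop :=
  forall x y (a : R), A x -> A y -> 0 <= a <= 1 ->
    f (a *: x + (1 - a) *: y) <=
      a * f x + (1 - a) * f y - s / 2 * a * (1 - a) * enorm (x - y) ^+ 2.

Definition strongly_concave (R : realType) (d : nat) (A : set 'rV[R]_d)
    (s : R) (f : 'rV[R]_d -> R) : Prop :=
  strongly_convex A s (fun x => - f x).

Definition nondecreasing_each (R : realType) (d : nat) (A : set 'rV[R]_d)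
    (f : 'rV[R]_d -> R) : Prop :=
  forall x y (j : 'I_d), A x -> A y ->
    (forall k, k != j -> x ord0 k = y ord0 k) -> x ord0 j <= y ord0 j ->
    f x <= f y.

Definition elipschitz (R : realType) (d : nat) (A : set 'rV[R]_d)
    (k : R) (f : 'rV[R]_d -> R) : Prop :=
  forall x y, A x -> A y -> `|f x - f y| <= k * enorm (x - y).

(* A maximizer of phi over A, with default value 0 if there is none. *)
Definition argmax (R : realType) (d : nat) (A : set 'rV[R]_d)
    (phi : 'rV[R]_d -> R) : 'rV[R]_d :=
  xget 0 [set x | A x /\ forall y, A y -> phi y <= phi x].

(* Points z = (x, y) of (R^d)^m x (R^d)^n. *)
Definition point_pair (R : realType) (m n d : nat) : Type :=
  (('I_m -> 'rV[R]_d) * ('I_n -> 'rV[R]_d))%type.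

Definition Zset (R : realType) (m n d : nat)
    (X : 'I_m -> set 'rV[R]_d) (Y : 'I_n -> set 'rV[R]_d) :
    set (point_pair R m n d) :=
  [set z | (forall i, X i (z.1 i)) /\ (forall i, Y i (z.2 i))].

Definition Sset (R : realType) (m n d : nat)
    (X : 'I_m -> set 'rV[R]_d) (Y : 'I_n -> set 'rV[R]_d) :
    set (point_pair R m n d) :=
  [set z | Zset X Y z /\ \sum_(i < m) z.1 i = \sum_(i < n) z.2 i].

Definition Fobj (R : realType) (m n d : nat)
    (f : 'I_m -> 'rV[R]_d -> R) (g : 'I_n -> 'rV[R]_d -> R)
    (z : point_pair R m n d) : R :=
  \sum_(i < m) f i (z.1 i) - \sum_(i < n) g i (z.2 i).

(* The supremum is the real-valued `sup` of the library; it is the true one when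
   the set is nonempty and bounded above, e.g. for compact X i, Y i and
   continuous f i, g i. *)
Definition Gdual (R : realType) (m n d : nat)
    (X : 'I_m -> set 'rV[R]_d) (f : 'I_m -> 'rV[R]_d -> R)
    (Y : 'I_n -> set 'rV[R]_d) (g : 'I_n -> 'rV[R]_d -> R)
    (lam : 'rV[R]_d) : R :=
  sup [set Fobj f g z + \sum_(i < n) dot lam (z.2 i)
             - \sum_(i < m) dot lam (z.1 i) | z in Zset X Y].

Definition xtilde (R : realType) (m d : nat)
    (X : 'I_m -> set 'rV[R]_d) (f : 'I_m -> 'rV[R]_d -> R)
    (lam : 'rV[R]_d) (i : 'I_m) : 'rV[R]_d :=
  argmax (X i) (fun x => f i x - dot lam x).

Definition ytilde (R : realType) (n d : nat)
    (Y : 'I_n -> set 'rV[R]_d) (g : 'I_n -> 'rV[R]_d -> R)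
    (lam : 'rV[R]_d) (i : 'I_n) : 'rV[R]_d :=
  argmax (Y i) (fun y => dot lam y - g i y).

Definition ztilde (R : realType) (m n d : nat)
    (X : 'I_m -> set 'rV[R]_d) (f : 'I_m -> 'rV[R]_d -> R)
    (Y : 'I_n -> set 'rV[R]_d) (g : 'I_n -> 'rV[R]_d -> R)
    (lam : 'rV[R]_d) : point_pair R m n d :=
  (xtilde X f lam, ytilde Y g lam).

Definition Dztilde (R : realType) (m n d : nat)
    (X : 'I_m -> set 'rV[R]_d) (f : 'I_m -> 'rV[R]_d -> R)
    (Y : 'I_n -> set 'rV[R]_d) (g : 'I_n -> 'rV[R]_d -> R)
    (lam : 'rV[R]_d) : 'rV[R]_d :=
  \sum_(i < n) ytilde Y g lam i - \sum_(i < m) xtilde X f lam i.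

(* `inf` over the finite range of s is the minimum, for m, n >= 1. *)
Definition sigma_min (R : realType) (m n : nat)
    (s1 : 'I_m -> R) (s2 : 'I_n -> R) : R :=
  Num.min (inf (range s1)) (inf (range s2)).

Definition Kconst (R : realType) (m n : nat)
    (K1 : 'I_m -> R) (K2 : 'I_n -> R) : R :=
  Num.sqrt (\sum_(i < m) K1 i ^+ 2 + \sum_(i < n) K2 i ^+ 2).

Definition kappa (R : realType) (m n : nat)
    (s1 : 'I_m -> R) (s2 : 'I_n -> R) : R :=
  \sum_(i < m) (s1 i)^-1 + \sum_(i < n) (s2 i)^-1.

(* The sequences lam, mu are generated by the fast gradient descent with step eta
   and gradient D; (t - 1) is a natural subtraction, exact since t >= 1. *)
Definition fast_gradient_descent (R : realType) (d : nat) (eta : R)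
    (D : 'rV[R]_d -> 'rV[R]_d) (lam mu : nat -> 'rV[R]_d) : Prop :=
  mu 0%N = lam 0%N /\
  forall t : nat, (1 <= t)%N ->
    lam t = mu (t - 1)%N - eta *: D (mu (t - 1)%N) /\
    mu t = lam t + ((t - 1)%:R / (t + 2)%:R) *: (lam t - lam (t - 1)%N).

(* Main.v *)
Require Import Defs.
From HB Require Import structures.
From mathcomp Require Import all_boot all_order all_algebra.
From mathcomp Require Import all_classical all_reals all_analysis.
From mathcomp Require Import ring lra.

Set Implicit Arguments.
Unset Strict Implicit.
Unset Printing Implicit Defensive.

Import Order.TTheory GRing.Theory Num.Theory.
Import numFieldNormedType.Exports.

Local Open Scope classical_set_scope.
Local Open Scope ring_scope.

(* Idea.  Strong concavity makes the Lagrangian L(z, lam) fall below its maximum over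
   Z at least quadratically in the distance from z to the maximizer ztilde(lam).
   This single growth estimate gives the kappa-smoothness of the dual G (with
   subgradient Dztilde, so no differentiation is needed), and, combined with the
   absence of a duality gap, sigma/2 |zs - ztilde(lam)|^2 <= G(lam) - G(ls).
   Smoothness gives |Dztilde(lam)|^2 <= 2 kappa (G(lam) - G(ls)).  Both bounds
   then follow from Nesterov's rate
   G(lam_t) - G(ls) <= 2 |lam_0 - ls|^2 / (eta (t+1)^2). *)

(** * Euclidean scalar product, and the Young and Cauchy-Schwarz inequalities *)

Lemma dotC (R : realType) (d : nat) (u v : 'rV[R]_d) : dot u v = dot v u.
Proof. by apply: eq_bigr => j _; rewrite mulrC. Qed.

Lemma dotDl (R : realType) (d : nat) (u v w : 'rV[R]_d) :
  dot (u + v) w = dot u w + dot v w.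
Proof. by rewrite -big_split; apply: eq_bigr => j _ /=; rewrite mxE mulrDl. Qed.

Lemma dotZl (R : realType) (d : nat) (a : R) (u w : 'rV[R]_d) :
  dot (a *: u) w = a * dot u w.
Proof. by rewrite mulr_sumr; apply: eq_bigr => j _ /=; rewrite mxE mulrA. Qed.

Lemma dotDr (R : realType) (d : nat) (u v w : 'rV[R]_d) :
  dot w (u + v) = dot w u + dot w v.
Proof. by rewrite dotC dotDl !(dotC w). Qed.

Lemma dotZr (R : realType) (d : nat) (a : R) (u w : 'rV[R]_d) :
  dot w (a *: u) = a * dot w u.
Proof. by rewrite dotC dotZl dotC. Qed.

Lemma dotNl (R : realType) (d : nat) (u w : 'rV[R]_d) :
  dot (- u) w = - dot u w.
Proof. by rewrite -scaleN1r dotZl mulN1r. Qed.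

Lemma dotNr (R : realType) (d : nat) (u w : 'rV[R]_d) :
  dot w (- u) = - dot w u.
Proof. by rewrite dotC dotNl dotC. Qed.

Lemma dot_sumr (R : realType) (d : nat) (I : finType) (u : I -> 'rV[R]_d)
    (w : 'rV[R]_d) :
  dot w (\sum_i u i) = \sum_i dot w (u i).
Proof.
rewrite /dot exchange_big; apply: eq_bigr => j _ /=.
by rewrite summxE mulr_sumr.
Qed.

Lemma dot_ge0 (R : realType) (d : nat) (u : 'rV[R]_d) : 0 <= dot u u.
Proof. by apply: sumr_ge0 => j _; rewrite -expr2 sqr_ge0. Qed.

Lemma dot_eq0 (R : realType) (d : nat) (u : 'rV[R]_d) : dot u u <= 0 -> u = 0.
Proof.
move=> u0; have /eqP : dot u u = 0 by apply/le_anti; rewrite u0 dot_ge0.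
rewrite psumr_eq0 => [/allP u0'|j _]; last by rewrite -expr2 sqr_ge0.
apply/rowP => j; rewrite mxE; apply/eqP.
by have := u0' j (mem_index_enum _); rewrite -expr2 sqrf_eq0.
Qed.

Lemma enorm_ge0 (R : realType) (d : nat) (u : 'rV[R]_d) : 0 <= enorm u.
Proof. exact: sqrtr_ge0. Qed.

Lemma enorm_sqr (R : realType) (d : nat) (u : 'rV[R]_d) :
  enorm u ^+ 2 = dot u u.
Proof. by rewrite sqr_sqrtr // dot_ge0. Qed.

(** The gap between the two sides is [s^-1 / 2] times the square norm of [u - s *: v]. This
    Fenchel-Young bound for [s / 2 * dot v v] turns strong concavity into smoothness of the dual. *)
Lemma dot_young (R : realType) (d : nat) (s : R) (u v : 'rV[R]_d) : 0 < s ->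
  dot u v - s / 2 * dot v v <= s^-1 / 2 * dot u u.
Proof.
move=> s0; have := dot_ge0 (u - s *: v).
rewrite !(dotDl, dotDr, dotNl, dotNr, dotZl, dotZr) (dotC v u).
set N := (N in 0 <= N) => N0.
have -> : s^-1 / 2 * dot u u = dot u v - s / 2 * dot v v + s^-1 / 2 * N.
  by rewrite /N; field; rewrite gt_eqF.
by rewrite lerDl mulr_ge0 // divr_ge0 // invr_ge0 ltW.
Qed.

(** Lagrange's identity: the double sum of the squares of [a i * b j - a j * b i] is twice the
    gap. *)
Lemma cauchy_schwarz_sum (R : realType) (I : finType) (a b : I -> R) :
  (\sum_i a i * b i) ^+ 2 <= (\sum_i a i ^+ 2) * (\sum_i b i ^+ 2).
Proof.
have: 0 <= \sum_i \sum_j (a i * b j - a j * b i) ^+ 2.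
  by apply: sumr_ge0 => i _; apply: sumr_ge0 => j _; exact: sqr_ge0.
suff -> : \sum_i \sum_j (a i * b j - a j * b i) ^+ 2 =
  2 * ((\sum_i a i ^+ 2) * (\sum_i b i ^+ 2)) - 2 * (\sum_i a i * b i) ^+ 2.
  lra.
have e (x y : I -> R) :
    (\sum_i x i) * (\sum_j y j) = \sum_i \sum_j x i * y j.
  by rewrite mulr_suml; apply: eq_bigr => i _; rewrite mulr_sumr.
have -> : 2 * ((\sum_i a i ^+ 2) * (\sum_i b i ^+ 2)) =
    (\sum_i a i ^+ 2) * (\sum_i b i ^+ 2) +
    (\sum_i b i ^+ 2) * (\sum_i a i ^+ 2) by ring.
rewrite expr2 !e mulr_sumr -sumrN -!big_split; apply: eq_bigr => i _ /=.
rewrite mulr_sumr -sumrN -!big_split; apply: eq_bigr => j _ /=.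
ring.
Qed.

(** * Maximizing a strongly concave function over a compact convex set *)

(** Bridges the Euclidean norm and the sup-norm topology: the squared Euclidean distance to [x] is a
    polynomial in the coordinates, hence continuous. *)
Lemma elipschitz_continuous (R : realType) (d : nat) (A : set 'rV[R]_d)
    (k : R) (f : 'rV[R]_d -> R) :
  elipschitz A k f -> {within A, continuous f}.
Proof.
move=> fK; apply/subspace_continuousP => x Ax; apply/cvgrPdist_le => e e0 /=.
(* Dividing by [|k| + 1] instead of [k] is safe whatever the sign of [k]. *)
have k0 : 0 < `|k| + 1 by rewrite ltr_wpDl.
have cont : continuous (fun y : 'rV[R]_d =>
    \sum_j (x ord0 j - y ord0 j) * (x ord0 j - y ord0 j)).
  apply: continuous_big => [|j _ y]; first exact: add_continuous.
  have cxj : continuous_at y (fun z : 'rV[R]_d => x ord0 j - z ord0 j).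
    by apply: continuousB; [exact: cst_continuous|exact: coord_continuous].
  exact: (continuousM cxj cxj).
have dotE (y : 'rV[R]_d) : \sum_j (x ord0 j - y ord0 j) * (x ord0 j - y ord0 j) =
    dot (x - y) (x - y) by apply: eq_bigr => j _; rewrite !mxE.
have /cvgrPdist_lt := cont x.
move=> /(_ ((e / (`|k| + 1)) ^+ 2)) /=; rewrite exprn_gt0 ?divr_gt0 // => /(_ isT).
move=> H; apply: filterS H => y; rewrite !dotE subrr -(scale0r 0) dotZl mul0r.
rewrite sub0r normrN => H Ay.
have {}H : enorm (x - y) <= e / (`|k| + 1).
  rewrite -ler_sqr ?nnegrE ?enorm_ge0 ?divr_ge0 ?ltW // enorm_sqr.
  exact: le_lt_trans (ler_norm _) H.
apply: (@le_trans _ _ (k * enorm (x - y))); first exact: fK.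
apply: (@le_trans _ _ ((`|k| + 1) * enorm (x - y))).
  by rewrite ler_wpM2r ?enorm_ge0 // (le_trans (ler_norm _)) // lerDl.
by rewrite mulrC -ler_pdivlMr.
Qed.

Lemma dot_continuous (R : realType) (d : nat) (l : 'rV[R]_d) :
  continuous (dot l).
Proof.
apply: continuous_big => [|j _ x]; first exact: add_continuous.
by apply: continuousM; [exact: cst_continuous|exact: coord_continuous].
Qed.

(** If the quadratic growth failed at [y], a short move from the maximizer towards [y] would exceed
    the maximum, by strong concavity along the segment. *)
Lemma argmax_growth (R : realType) (d : nat) (A : set 'rV[R]_d) (s : R)
    (phi : 'rV[R]_d -> R) :
  A !=set0 -> convex_set A -> compact A -> {within A, continuous phi} ->
  strongly_concave A s phi ->
  A (argmax A phi) /\ forall y, A y ->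
    phi y + s / 2 * dot (y - argmax A phi) (y - argmax A phi)
      <= phi (argmax A phi).
Proof.
move=> A0 convA compA cphi cvx.
have [x0 x0A x0max] := EVT_max_rV A0 compA cphi.
(* The maximizer [x0] from the extreme value theorem rules out the default value 0 of [argmax]. *)
have [Ax xmax] : A (argmax A phi) /\ forall y, A y -> phi y <= phi (argmax A phi).
  apply: (@xgetPex _ 0 [set x | A x /\ forall y, A y -> phi y <= phi x]).
  exists x0; split; first exact: set_mem.
  by move=> y Ay; apply: x0max; rewrite inE.
split=> // y Ay; move: (argmax A phi) Ax xmax => x Ax xmax.
set D := s / 2 * _; rewrite leNgt; apply/negP => lt_x.
have D0 : 0 < D by have := xmax _ Ay; lra.
(* With this weight [a * D] is half the assumed excess [phi y + D - phi x], while strong concavity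
   forces it to be at least the whole excess. *)
pose a := (phi y + D - phi x) / (2 * D).
have a01 : 0 < a <= 1.
  have DD : 0 < 2 * D by rewrite mulr_gt0.
  rewrite /a ltr_pdivlMr // ler_pdivrMr // mul0r mul1r.
  by have := xmax _ Ay; lra.
have [a0 a1] := andP a01.
have a01' : 0 <= a <= 1 by rewrite ltW.
have Az : A (a *: y + (1 - a) *: x).
  exact: set_mem (convA y x (Itv01 (ltW a0) a1) (mem_set Ay) (mem_set Ax)).
have := cvx _ _ a Ay Ax a01'; rewrite enorm_sqr.
have := xmax _ Az.
move=> zx.
have -> : s / 2 * a * (1 - a) * dot (y - x) (y - x) = a * ((1 - a) * D).
  by rewrite /D; ring.
move=> yx; have : a * ((1 - a) * D) <= a * (phi x - phi y) by lra.
rewrite ler_pM2l // mulrBl mul1r.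
have -> : a * D = (phi y + D - phi x) / 2 by rewrite /a; field; rewrite gt_eqF.
lra.
Qed.

(** * Nesterov's accelerated rate *)

Lemma fast_gradient_descent_rate (R : realType) (d : nat) (G : 'rV[R]_d -> R)
    (D : 'rV[R]_d -> 'rV[R]_d) (eta : R) (ls : 'rV[R]_d)
    (lam mu : nat -> 'rV[R]_d) :
  0 < eta ->
  (forall u v, G u + dot (v - u) (D u) <= G v) ->
  (forall u, G (u - eta *: D u) <= G u - eta / 2 * dot (D u) (D u)) ->
  (forall l, G ls <= G l) ->
  fast_gradient_descent eta D lam mu ->
  forall t, (1 <= t)%N -> (t + 1)%:R ^+ 2 * (G (lam t) - G ls)
    <= 2 / eta * dot (lam 0%N - ls) (lam 0%N - ls).
Proof.
move=> eta0 subgrad descent Gmin [mu0 lamS].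
(* [v] is determined by [mu t = (1 - a) lam t + a v t] with [a = 2 / (t + 2)];
   [t (t + 2) (G (lam t) - G ls) + V t] is the Lyapunov function. *)
pose v t := lam t + ((t%:R + 2) / 2) *: (mu t - lam t).
pose V t := 2 / eta * dot (v t - ls) (v t - ls).
have step t : (t%:R + 2) ^+ 2 * (G (lam t.+1) - G ls) + V t.+1
    <= t%:R * (t%:R + 2) * (G (lam t) - G ls) + V t.
  have [lamE muE] := lamS t.+1 isT.
  rewrite subn1 /= addSnnS natrD in lamE muE.
  have t0 : 0 <= t%:R :> R by [].
  (* At index [t.+1] the momentum factor is t/(t+3), exactly the value for which [v] moves by a pure
     gradient step of length eta (t+2)/2. *)
  have vE : v t.+1 - ls = (v t - ls) - (eta * (t%:R + 2) / 2) *: D (mu t).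
    rewrite /v muE lamE; apply/rowP => j; rewrite !mxE -natr1.
    by field; rewrite gt_eqF //; lra.
  have H1 := descent (mu t); rewrite -lamE in H1.
  have H2 := subgrad (mu t) (lam t); have H3 := subgrad (mu t) ls.
  have H4 : t%:R * dot (lam t - mu t) (D (mu t)) + 2 * dot (ls - mu t) (D (mu t))
      = - (2 * dot (v t - ls) (D (mu t))).
    rewrite -!dotZl -dotDl -dotNl; congr (dot _ _).
    by rewrite /v; apply/rowP => j; rewrite !mxE; field.
  (* Weights t+2 on the descent inequality, t on the subgradient inequality at [lam t] and 2 on the
     one at [ls]: the values [G (mu t)] cancel, and [H4] merges the linear terms. *)
  have H5 : (t%:R + 2) * (G (lam t.+1) - G ls) <= t%:R * (G (lam t) - G ls) +
      2 * dot (v t - ls) (D (mu t)) -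
      (t%:R + 2) * (eta / 2 * dot (D (mu t)) (D (mu t))).
    have := ler_wpM2l t0 H2.
    have : 0 <= t%:R + 2 :> R by lra.
    by move=> /ler_wpM2l /(_ _ _ H1); lra.
  have H6 : (t%:R + 2) ^+ 2 * (G (lam t.+1) - G ls) <=
      (t%:R + 2) * (t%:R * (G (lam t) - G ls) +
      2 * dot (v t - ls) (D (mu t)) -
      (t%:R + 2) * (eta / 2 * dot (D (mu t)) (D (mu t)))).
    by rewrite expr2 -mulrA ler_wpM2l //; lra.
  have -> : V t.+1 = V t - 2 * (t%:R + 2) * dot (v t - ls) (D (mu t)) +
      (t%:R + 2) ^+ 2 * (eta / 2) * dot (D (mu t)) (D (mu t)).
    rewrite /V vE; move: (v t - ls) (D (mu t)) => w q.
    rewrite !(dotDl, dotDr, dotNl, dotNr, dotZl, dotZr) (dotC q w).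
    by field; rewrite gt_eqF.
  lra.
have V0 t : 0 <= V t by rewrite mulr_ge0 ?dot_ge0 // divr_ge0 // ltW.
have inv t : t%:R * (t%:R + 2) * (G (lam t) - G ls) + V t <= V 0%N.
  elim: t => [|t IH]; first by rewrite !mul0r add0r.
  (* The weights telescope because (t+1)(t+3) is at most (t+2)^2. *)
  apply: le_trans (le_trans (step t) IH); rewrite lerD2r ler_wpM2r ?subr_ge0 //.
  have : 0 <= t%:R :> R by [].
  by rewrite -natr1; nra.
move=> [//|t] _.
have -> : 2 / eta * dot (lam 0%N - ls) (lam 0%N - ls) = V 0%N.
  by rewrite /V /v mu0 subrr scaler0 addr0.
(* Ending with [step t] rather than [inv t.+1] keeps the larger weight (t+2)^2 of the claim. *)
have := le_trans (step t) (inv t); have := V0 t.+1.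
rewrite addn1 -[t.+2]addn2 natrD; lra.
Qed.

(** * The Lagrangian, and smoothness of the dual function *)

(** Written exactly as the expression under [sup] in [Gdual], so that the two agree by
    conversion. *)
Definition lagrangian (R : realType) (m n d : nat)
    (f : 'I_m -> 'rV[R]_d -> R) (g : 'I_n -> 'rV[R]_d -> R)
    (z : point_pair R m n d) (lam : 'rV[R]_d) : R :=
  Fobj f g z + \sum_(i < n) dot lam (z.2 i) - \sum_(i < m) dot lam (z.1 i).

(** Each block keeps its own modulus, so that the smoothness constant becomes the sum of inverses
    [kappa]. *)
Definition weighted_sqdist (R : realType) (m n d : nat)
    (s1 : 'I_m -> R) (s2 : 'I_n -> R) (z w : point_pair R m n d) : R :=
  \sum_(i < m) s1 i / 2 * dot (z.1 i - w.1 i) (z.1 i - w.1 i) +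
  \sum_(i < n) s2 i / 2 * dot (z.2 i - w.2 i) (z.2 i - w.2 i).

Lemma lagrangianE (R : realType) (m n d : nat)
    (f : 'I_m -> 'rV[R]_d -> R) (g : 'I_n -> 'rV[R]_d -> R)
    (z : point_pair R m n d) (lam lam' : 'rV[R]_d) :
  lagrangian f g z lam' = lagrangian f g z lam +
    dot (lam' - lam) (\sum_(i < n) z.2 i - \sum_(i < m) z.1 i).
Proof.
rewrite /lagrangian dotDr dotNr !dotDl !dotNl -!dot_sumr; ring.
Qed.

Lemma dot_convex_comb (R : realType) (d : nat) (l x y : 'rV[R]_d) (a : R) :
  dot l (a *: x + (1 - a) *: y) = a * dot l x + (1 - a) * dot l y.
Proof. by rewrite dotDr !dotZr. Qed.

(** For fixed [lam] the Lagrangian splits into one problem per block. The linear terms leave the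
    moduli unchanged, so [argmax_growth] applies blockwise and the results add up. *)
Lemma ztilde_growth (R : realType) (m n d : nat)
    (X : 'I_m -> set 'rV[R]_d) (f : 'I_m -> 'rV[R]_d -> R)
    (Y : 'I_n -> set 'rV[R]_d) (g : 'I_n -> 'rV[R]_d -> R)
    (s1 : 'I_m -> R) (s2 : 'I_n -> R) (lam : 'rV[R]_d) :
  (forall i, [/\ X i !=set0, convex_set (X i), compact (X i),
     {within X i, continuous (f i)} & strongly_concave (X i) (s1 i) (f i)]) ->
  (forall i, [/\ Y i !=set0, convex_set (Y i), compact (Y i),
     {within Y i, continuous (g i)} & strongly_convex (Y i) (s2 i) (g i)]) ->
  Zset X Y (ztilde X f Y g lam) /\ forall z, Zset X Y z ->
    lagrangian f g z lam + weighted_sqdist s1 s2 z (ztilde X f Y g lam)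
      <= lagrangian f g (ztilde X f Y g lam) lam.
Proof.
move=> hX hY.
have growX i : X i (xtilde X f lam i) /\ forall x, X i x ->
    f i x - dot lam x + s1 i / 2 * dot (x - xtilde X f lam i) (x - xtilde X f lam i)
    <= f i (xtilde X f lam i) - dot lam (xtilde X f lam i).
  have [X0 cX kX fc fs] := hX i.
  apply: (argmax_growth X0 cX kX) => [x|x y a Xx Xy a01].
    by apply: cvgB; [exact: fc|apply: continuous_subspaceT => {}x; exact: dot_continuous].
  by have := fs x y a Xx Xy a01; rewrite dot_convex_comb; lra.
have growY i : Y i (ytilde Y g lam i) /\ forall y, Y i y ->
    dot lam y - g i y + s2 i / 2 * dot (y - ytilde Y g lam i) (y - ytilde Y g lam i)
    <= dot lam (ytilde Y g lam i) - g i (ytilde Y g lam i).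
  have [Y0 cY kY gc gs] := hY i.
  apply: (argmax_growth Y0 cY kY) => [x|x y a Yx Yy a01].
    by apply: cvgB; [apply: continuous_subspaceT => {}x; exact: dot_continuous|exact: gc].
  by have := gs x y a Yx Yy a01; rewrite dot_convex_comb; lra.
split=> [|z [zX zY]].
  by split=> i; [exact: (growX i).1|exact: (growY i).1].
have /(_ (index_enum _)) := ler_sum _ (fun i (_ : true) => (growX i).2 _ (zX i)).
have /(_ (index_enum _)) := ler_sum _ (fun i (_ : true) => (growY i).2 _ (zY i)).
rewrite !big_split /= !sumrN /lagrangian /weighted_sqdist /Fobj /=; lra.
Qed.

(** A maximizer makes the set of values nonempty and bounded above, so the real-valued [sup] is the
    true supremum. *)
Lemma Gdual_lagrangian (R : realType) (m n d : nat)
    (X : 'I_m -> set 'rV[R]_d) (f : 'I_m -> 'rV[R]_d -> R)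
    (Y : 'I_n -> set 'rV[R]_d) (g : 'I_n -> 'rV[R]_d -> R)
    (lam : 'rV[R]_d) (z : point_pair R m n d) :
  Zset X Y z ->
  (forall w, Zset X Y w -> lagrangian f g w lam <= lagrangian f g z lam) ->
  Gdual X f Y g lam = lagrangian f g z lam.
Proof.
move=> Zz zmax; apply/le_anti/andP; split.
  by apply: ge_sup => [|_ [w Zw <-]]; [exists (lagrangian f g z lam), z|exact: zmax].
apply: ub_le_sup; last by exists z.
by exists (lagrangian f g z lam) => _ [w Zw <-]; exact: zmax.
Qed.

(** The maximizer at [u] is a competitor at [v], and the Lagrangian is affine in the multiplier. *)
Lemma Gdual_subgradient (R : realType) (m n d : nat)
    (X : 'I_m -> set 'rV[R]_d) (f : 'I_m -> 'rV[R]_d -> R)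
    (Y : 'I_n -> set 'rV[R]_d) (g : 'I_n -> 'rV[R]_d -> R)
    (u v : 'rV[R]_d) :
  (forall l, Zset X Y (ztilde X f Y g l)) ->
  (forall l z, Zset X Y z ->
     lagrangian f g z l <= lagrangian f g (ztilde X f Y g l) l) ->
  Gdual X f Y g u + dot (v - u) (Dztilde X f Y g u) <= Gdual X f Y g v.
Proof.
move=> Zt tmax.
rewrite (Gdual_lagrangian (Zt u) (tmax u)) (Gdual_lagrangian (Zt v) (tmax v)).
by rewrite -[_ + _]lagrangianE; exact: tmax.
Qed.

(** The maximizer at [v] is a competitor at [u], and falls short there by its weighted distance to
    the maximizer at [u]. Young's inequality plays this deficit against the change of gradient; a
    block with modulus s costs |v-u|^2/(2s), and these costs sum to the [kappa] term. *)
Lemma Gdual_smooth (R : realType) (m n d : nat)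
    (X : 'I_m -> set 'rV[R]_d) (f : 'I_m -> 'rV[R]_d -> R)
    (Y : 'I_n -> set 'rV[R]_d) (g : 'I_n -> 'rV[R]_d -> R)
    (s1 : 'I_m -> R) (s2 : 'I_n -> R) (u v : 'rV[R]_d) :
  (forall i, 0 < s1 i) -> (forall i, 0 < s2 i) ->
  (forall l, Zset X Y (ztilde X f Y g l)) ->
  (forall l z, Zset X Y z ->
     lagrangian f g z l + weighted_sqdist s1 s2 z (ztilde X f Y g l)
       <= lagrangian f g (ztilde X f Y g l) l) ->
  Gdual X f Y g v <= Gdual X f Y g u + dot (v - u) (Dztilde X f Y g u) +
    kappa s1 s2 / 2 * dot (v - u) (v - u).
Proof.
move=> s1_gt0 s2_gt0 Zt tgrow.
have tmax l z : Zset X Y z ->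
    lagrangian f g z l <= lagrangian f g (ztilde X f Y g l) l.
  move=> /(tgrow l); apply: le_trans; rewrite lerDl.
  by apply: addr_ge0; apply: sumr_ge0 => i _;
    rewrite mulr_ge0 ?dot_ge0 // divr_ge0 // ltW.
rewrite (Gdual_lagrangian (Zt u) (tmax u)) (Gdual_lagrangian (Zt v) (tmax v)).
rewrite (lagrangianE f g _ u); have := tgrow u _ (Zt v).
rewrite /Dztilde /weighted_sqdist /=; move: (v - u) => h.
set x := xtilde X f v; set y := ytilde Y g v.
set x' := xtilde X f u; set y' := ytilde Y g u => zgrow.
(* The x-blocks enter [Dztilde] with a minus sign, hence Young's inequality with [- h]. *)
have H1 : - (dot h (\sum_i x i) - dot h (\sum_i x' i)) -
    \sum_i s1 i / 2 * dot (x i - x' i) (x i - x' i) <=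
    (\sum_i (s1 i)^-1) / 2 * dot h h.
  rewrite !dot_sumr -!sumrN -!big_split /= -sumrN -big_split /= !mulr_suml.
  apply: ler_sum => i _.
  have := dot_young (- h) (x i - x' i) (s1_gt0 i).
  rewrite !(dotNl, dotDr, dotNr). lra.
have H2 : (dot h (\sum_i y i) - dot h (\sum_i y' i)) -
    \sum_i s2 i / 2 * dot (y i - y' i) (y i - y' i) <=
    (\sum_i (s2 i)^-1) / 2 * dot h h.
  rewrite !dot_sumr -!sumrN -!big_split /= !mulr_suml.
  apply: ler_sum => i _.
  have := dot_young h (y i - y' i) (s2_gt0 i).
  rewrite !(dotNl, dotDr, dotNr). lra.
rewrite /kappa !(dotDr, dotNr); lra.
Qed.

(** * Lipschitz bound for the primal objective, and the constants *)

Definition sqdist (R : realType) (m n d : nat) (z w : point_pair R m n d) : R :=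
  \sum_(i < m) enorm (z.1 i - w.1 i) ^+ 2 +
  \sum_(i < n) enorm (z.2 i - w.2 i) ^+ 2.

(** Blockwise Lipschitz bounds, combined by a single Cauchy-Schwarz inequality over the disjoint sum
    of the two index sets. *)
Lemma Fobj_lipschitz (R : realType) (m n d : nat)
    (X : 'I_m -> set 'rV[R]_d) (f : 'I_m -> 'rV[R]_d -> R)
    (Y : 'I_n -> set 'rV[R]_d) (g : 'I_n -> 'rV[R]_d -> R)
    (K1 : 'I_m -> R) (K2 : 'I_n -> R) (z w : point_pair R m n d) :
  (forall i, elipschitz (X i) (K1 i) (f i)) ->
  (forall i, elipschitz (Y i) (K2 i) (g i)) ->
  Zset X Y z -> Zset X Y w ->
  `|Fobj f g z - Fobj f g w| <= Kconst K1 K2 * Num.sqrt (sqdist z w).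
Proof.
move=> fK gK [zX zY] [wX wY].
pose a (i : 'I_m + 'I_n) := match i with inl j => K1 j | inr j => K2 j end.
pose b (i : 'I_m + 'I_n) := match i with
  | inl j => enorm (z.1 j - w.1 j) | inr j => enorm (z.2 j - w.2 j) end.
have := cauchy_schwarz_sum a b; rewrite !big_sumType /= => CS.
rewrite /Kconst -sqrtrM; last first.
  by apply: addr_ge0; apply: sumr_ge0 => i _; exact: sqr_ge0.
apply: le_trans (ler_wsqrtr CS); rewrite sqrtr_sqr.
apply: le_trans (ler_norm _).
have -> : Fobj f g z - Fobj f g w = \sum_(i < m) (f i (z.1 i) - f i (w.1 i)) -
    \sum_(i < n) (g i (z.2 i) - g i (w.2 i)).
  by rewrite /Fobj !big_split /= !sumrN; ring.
apply: le_trans (ler_normB _ _) _; apply: lerD.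
  by apply: le_trans (ler_norm_sum _ _ _) _; apply: ler_sum => i _; exact: fK.
by apply: le_trans (ler_norm_sum _ _ _) _; apply: ler_sum => i _; exact: gK.
Qed.

(** Over a nonempty finite index set the infimum is bounded below by the value at a minimizing
    index, which is positive. *)
Lemma inf_range_ord (R : realType) (n : nat) (s : 'I_n -> R) :
  (1 <= n)%N -> (forall i, 0 < s i) ->
  0 < inf (range s) /\ forall i, inf (range s) <= s i.
Proof.
case: n s => // n s _ s_gt0.
pose i0 := [arg min_(i < ord0 | true) s i]%O.
have i0min j : s i0 <= s j by rewrite /i0; case: arg_minP => // i _; apply.
split=> [|i].
  apply: lt_le_trans (s_gt0 i0) _; apply: lb_le_inf; first by exists (s i0), i0.
  by move=> _ [j _ <-].
by apply: ge_inf; [exists (s i0) => _ [j _ <-]|exists i].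
Qed.

Lemma sigma_min_sqdist (R : realType) (m n d : nat)
    (s1 : 'I_m -> R) (s2 : 'I_n -> R) (z w : point_pair R m n d) :
  (1 <= m)%N -> (1 <= n)%N -> (forall i, 0 < s1 i) -> (forall i, 0 < s2 i) ->
  0 < sigma_min s1 s2 /\
  sigma_min s1 s2 / 2 * sqdist z w <= weighted_sqdist s1 s2 z w.
Proof.
move=> m1 n1 /(inf_range_ord m1)[i1 le1] /(inf_range_ord n1)[i2 le2].
split; first by rewrite lt_min i1 i2.
rewrite /sqdist /weighted_sqdist mulrDr !mulr_sumr; apply: lerD.
  apply: ler_sum => i _; rewrite enorm_sqr ler_wpM2r ?dot_ge0 //.
  by rewrite ler_wpM2r // ge_min le1.
apply: ler_sum => i _; rewrite enorm_sqr ler_wpM2r ?dot_ge0 //.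
by rewrite ler_wpM2r // ge_min le2 orbT.
Qed.

Lemma kappa_gt0 (R : realType) (m n : nat) (s1 : 'I_m -> R) (s2 : 'I_n -> R) :
  (1 <= m)%N -> (forall i, 0 < s1 i) -> (forall i, 0 < s2 i) ->
  0 < kappa s1 s2.
Proof.
case: m s1 => // m s1 _ s1_gt0 s2_gt0.
rewrite /kappa big_ord_recl -addrA ltr_pwDl ?invr_gt0 //.
by apply: addr_ge0; apply: sumr_ge0 => i _; rewrite invr_ge0 ltW.
Qed.

(** * From the dual rate to the primal and feasibility bounds *)

Theorem theorem2 (R : realType) (m n d : nat)
    (X : 'I_m -> set 'rV[R]_d) (f : 'I_m -> 'rV[R]_d -> R)
    (Y : 'I_n -> set 'rV[R]_d) (g : 'I_n -> 'rV[R]_d -> R)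
    (eps c : R) (s1 K1 : 'I_m -> R) (s2 K2 : 'I_n -> R)
    (hm : (1 <= m)%N) (hn : (1 <= n)%N) (hd : (1 <= d)%N)
    (heps : 0 < eps) (hc : 0 < c)
    (hX : forall i : 'I_m,
      [/\ convex_set (X i), compact (X i), X i `<=` @orthant R d,
          @cube R d eps `<=` X i & X i `<=` @cube R d c])
    (hY : forall i : 'I_n,
      [/\ convex_set (Y i), compact (Y i), Y i `<=` @orthant R d,
          @cube R d eps `<=` Y i & Y i `<=` @cube R d c])
    (hf : forall i : 'I_m,
      [/\ forall x, X i x -> 0 <= f i x, 0 < s1 i,
          strongly_concave (X i) (s1 i) (f i),
          nondecreasing_each (X i) (f i) & f i 0 = 0])
    (hg : forall i : 'I_n,
      [/\ forall y, Y i y -> 0 <= g i y, 0 < s2 i,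
          strongly_convex (Y i) (s2 i) (g i),
          nondecreasing_each (Y i) (g i) & g i 0 = 0])
    (hfK : forall i : 'I_m, elipschitz (X i) (K1 i) (f i))
    (hgK : forall i : 'I_n, elipschitz (Y i) (K2 i) (g i))
    (zs : point_pair R m n d)
    (hzs : Sset X Y zs /\ forall z, Sset X Y z -> Fobj f g z <= Fobj f g zs)
    (ls : 'rV[R]_d)
    (hls : forall l : 'rV[R]_d, Gdual X f Y g ls <= Gdual X f Y g l)
    (eta : R) (heta : 0 < eta <= 1 / kappa s1 s2)
    (lam mu : nat -> 'rV[R]_d)
    (hlam : fast_gradient_descent eta (Dztilde X f Y g) lam mu) :
  forall t : nat, (1 <= t)%N ->
    `|Fobj f g (ztilde X f Y g (lam t)) - Fobj f g zs| <=
       2 * Kconst K1 K2 / Num.sqrt (sigma_min s1 s2 * eta)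
         * (enorm (lam 0%N - ls) / (t + 1)%:R) /\
    enorm (Dztilde X f Y g (lam t)) <=
       2 * Num.sqrt (kappa s1 s2 / eta) * (enorm (lam 0%N - ls) / (t + 1)%:R).
Proof.
have s1_gt0 i : 0 < s1 i by have [] := hf i.
have s2_gt0 i : 0 < s2 i by have [] := hg i.
have k_gt0 := @kappa_gt0 R m n s1 s2 hm s1_gt0 s2_gt0.
have [eta_gt0 eta_le] := andP heta.
have cube0 (A : set 'rV[R]_d) : @cube R d eps `<=` A -> A !=set0.
  by move=> cA; exists 0; apply: cA => j; rewrite mxE lexx ltW.
have growth l : Zset X Y (ztilde X f Y g l) /\ forall z, Zset X Y z ->
    lagrangian f g z l + weighted_sqdist s1 s2 z (ztilde X f Y g l)
      <= lagrangian f g (ztilde X f Y g l) l.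
  apply: ztilde_growth => i.
    have [cX kX _ /cube0 X0 _] := hX i; have [_ _ fs _ _] := hf i.
    by split=> //; exact: elipschitz_continuous (hfK i).
  have [cY kY _ /cube0 Y0 _] := hY i; have [_ _ gs _ _] := hg i.
  by split=> //; exact: elipschitz_continuous (hgK i).
have Zt l := (growth l).1; have tgrow l := (growth l).2.
have w_ge0 z w : 0 <= weighted_sqdist s1 s2 z w.
  by apply: addr_ge0; apply: sumr_ge0 => i _;
    rewrite mulr_ge0 ?dot_ge0 // divr_ge0 // ltW.
have tmax l z (Zz : Zset X Y z) :
    lagrangian f g z l <= lagrangian f g (ztilde X f Y g l) l.
  by apply: le_trans (tgrow l z Zz); rewrite lerDl.
have GE l := Gdual_lagrangian (Zt l) (tmax l).
(* Stated for any step [a] because it serves twice: with [eta] for the algorithm and with the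
   inverse of [kappa] for [grad_le]. *)
have descent a l : 0 < a -> a * kappa s1 s2 <= 1 ->
    Gdual X f Y g (l - a *: Dztilde X f Y g l) <= Gdual X f Y g l -
      a / 2 * dot (Dztilde X f Y g l) (Dztilde X f Y g l).
  move=> a0 ak.
  have := Gdual_smooth l (l - a *: Dztilde X f Y g l) s1_gt0 s2_gt0 Zt tgrow.
  have -> : l - a *: Dztilde X f Y g l - l = - (a *: Dztilde X f Y g l).
    by rewrite addrAC subrr sub0r.
  move/le_trans; apply.
  rewrite !(dotNl, dotNr, dotZl, dotZr).
  have := dot_ge0 (Dztilde X f Y g l); move: (dot _ _) => q q0.
  have : a * q * (a * kappa s1 s2) <= a * q by rewrite ler_piMr // mulr_ge0 // ltW.
  by lra.
have eta_k : eta * kappa s1 s2 <= 1 by move: eta_le; rewrite ler_pdivlMr.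
(* A gradient step of length 1/kappa from [l] cannot go below the minimum [Gdual X f Y g ls]. *)
have grad_le l : dot (Dztilde X f Y g l) (Dztilde X f Y g l) <=
    2 * kappa s1 s2 * (Gdual X f Y g l - Gdual X f Y g ls).
  have k1 : (kappa s1 s2)^-1 * kappa s1 s2 <= 1 by rewrite mulVf ?gt_eqF.
  have k0 : 0 < (kappa s1 s2)^-1 by rewrite invr_gt0.
  have := le_trans (hls _) (descent _ l k0 k1).
  move: (dot _ _) => q H.
  have -> : q = 2 * kappa s1 s2 * ((kappa s1 s2)^-1 / 2 * q).
    by field; rewrite gt_eqF.
  by rewrite ler_wpM2l ?mulr_ge0 ?(ltW k_gt0) //; lra.
have [[Zzs zsS] zsmax] := hzs.
have lagr_zs l : lagrangian f g zs l = Fobj f g zs.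
  by rewrite /lagrangian -!dot_sumr zsS addrK.
(* Complementarity at the dual optimum: the gradient vanishes there, so
   [ztilde ls] is primal feasible and there is no duality gap. *)
have strong_duality : Gdual X f Y g ls <= Fobj f g zs.
  have : Dztilde X f Y g ls = 0.
    by apply: dot_eq0; apply: le_trans (grad_le ls) _; rewrite subrr mulr0.
  move=> /eqP; rewrite subr_eq0 => /eqP DS.
  rewrite GE.
  have -> : lagrangian f g (ztilde X f Y g ls) ls = Fobj f g (ztilde X f Y g ls).
    by rewrite /lagrangian -!dot_sumr DS addrK.
  by apply: zsmax; split.
have rate := fast_gradient_descent_rate eta_gt0
  (fun u v => Gdual_subgradient u v Zt tmax)
  (fun u => descent eta u eta_gt0 eta_k) hls hlam.
move=> t t1; have {}rate := rate t t1.
have t0 : 0 < (t + 1)%:R :> R by rewrite ltr0n addn1.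
rewrite -enorm_sqr in rate.
set E := enorm (lam 0%N - ls) in rate *.
have E0 : 0 <= E by exact: enorm_ge0.
have {}rate : Gdual X f Y g (lam t) - Gdual X f Y g ls <=
    2 / eta * (E / (t + 1)%:R) ^+ 2.
  by rewrite expr_div_n mulrA ler_pdivlMr ?exprn_gt0 // mulrC.
have r0 : 0 <= E / (t + 1)%:R by rewrite divr_ge0 // ltW.
move: (E / _) r0 rate => r r0 rate; split; last first.
  (* The feasibility bound comes first: squared, it is [grad_le] followed by [rate]. *)
  rewrite -ler_sqr ?nnegrE ?enorm_ge0 ?mulr_ge0 ?sqrtr_ge0 //.
  rewrite enorm_sqr !exprMn sqr_sqrtr ?divr_ge0 ?(ltW k_gt0) ?(ltW eta_gt0) //.
  apply: le_trans (grad_le _) _.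
  have -> : 2 ^+ 2 * (kappa s1 s2 / eta) * r ^+ 2 =
      2 * kappa s1 s2 * (2 / eta * r ^+ 2) by field; rewrite gt_eqF.
  by rewrite ler_wpM2l // mulr_ge0 // ltW.
have [sig_gt0 sig_le] := sigma_min_sqdist zs (ztilde X f Y g (lam t)) hm hn s1_gt0 s2_gt0.
rewrite distrC; apply: le_trans (Fobj_lipschitz hfK hgK Zzs (Zt _)) _.
have -> : 2 * Kconst K1 K2 / Num.sqrt (sigma_min s1 s2 * eta) * r =
  Kconst K1 K2 * (2 / Num.sqrt (sigma_min s1 s2 * eta) * r) by ring.
rewrite ler_wpM2l ?sqrtr_ge0 //.
have N0 : 0 <= sqdist zs (ztilde X f Y g (lam t)).
  by apply: addr_ge0; apply: sumr_ge0 => i _; exact: sqr_ge0.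
rewrite -ler_sqr ?nnegrE ?mulr_ge0 ?invr_ge0 ?sqrtr_ge0 //.
rewrite !exprMn exprVn !sqr_sqrtr ?mulr_ge0 ?(ltW sig_gt0) ?(ltW eta_gt0) //.
(* Growth at [lam t], tested at [zs], where feasibility reduces the Lagrangian to the objective.
   With [strong_duality] the weighted distance is at most the dual gap, which [rate] controls. *)
have := tgrow (lam t) _ Zzs; rewrite lagr_zs -GE => gap.
have -> : 2 ^+ 2 / (sigma_min s1 s2 * eta) * r ^+ 2 =
    2 / sigma_min s1 s2 * (2 / eta * r ^+ 2).
  by field; rewrite !gt_eqF.
rewrite mulrAC ler_pdivlMr //.
by lra.
Qed.
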